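(* Let $\mathbb{K}$ be a field of characteristic zero, let $A$ be a finite-dimensional pre-Malcev algebra over $\mathbb{K}$, let $V$ be a finite-dimensional $A$-bimodule, and let $(N,S)$ be a Nijenhuis pair on $A$ with respect to $V$. Then the linear map $N\oplus S:A\oplus V\to A\oplus V$, $(x,u)\mapsto (N(x),S(u))$, is a Nijenhuis operator on the semi-direct product $A\ltimes V$.
   Context: A pre-Malcev algebra over $\mathbb{K}$ is a nonassociative algebra $A$ over $\mathbb{K}$ such that for all $x,y,z,t\in A$: $(yz-zy)(xt)+((xy-yx)z-z(xy-yx))t+y((xz-zx)t)-x(y(zt))+z(x(yt))=0$. An $A$-bimodule is a vector space $V$ with linear maps $\ell,r:A\to\mathfrak{gl}(V)$, $x\mapsto \ell_x$, $x\mapsto r_x$, such that for all $x,y,z\in A$: (i) $r_x r_y r_z-r_x r_y\ell_z-r_x\ell_y r_z+r_x\ell_y\ell_z-r_{z(yx)}+\ell_y r_{zx}+\ell_{zy}r_x-\ell_{yz}r_x-\ell_z r_x\ell_y+\ell_z r_x r_y=0$; (ii) $r_{x}r_{y}\ell_{z}-r_{x}r_{y}r_{z}-r_{x}\ell_{y}\ell_{z}+r_{x}\ell_{y}r_{z}-\ell_{z}r_{yx}+\ell_{y}\ell_{z}r_{x}+r_{zx}r_{y}-r_{zx}\ell_{y}-r_{(yz)x}+r_{(zy)x}=0$; (iii) $r_{x}\ell_{yz}-r_{x}\ell_{zy}-r_{x}r_{yz}+r_{x}r_{zy}-\ell_{y}\ell_{z}r_{x}+r_{y(zx)}+r_{yx}\ell_{z}-r_{yx}r_{z}-\ell_{z}r_{x}r_{y}+\ell_{z}r_{x}\ell_{y}=0$;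 (iv) $\ell_{(xy)z}-\ell_{(yx)z}-\ell_{z(xy)}+\ell_{z(yx)}-\ell_{x}\ell_{y}\ell_{z}+\ell_{z}\ell_{x}\ell_{y}+\ell_{yz}\ell_{x}-\ell_{zy}\ell_{x}-\ell_{y}\ell_{zx}+\ell_{y}\ell_{xz}=0$. The semi-direct product $A\ltimes V$ is $A\oplus V$ with multiplication $(x,u)(y,v)=(xy,\ell_x(v)+r_y(u))$; it is a pre-Malcev algebra. A Nijenhuis operator on a nonassociative algebra $B$ is a linear map $N:B\to B$ with $N(x)N(y)=N(N(x)y+xN(y)-N(xy))$ for all $x,y\in B$. A Nijenhuis pair on $A$ with respect to $V$ is a pair $(N,S)$ where $N:A\to A$ is a Nijenhuis operator on $A$ and $S:V\to V$ is a linear map such that for all $x\in A$: $\ell_{N(x)}S=S\ell_{N(x)}+S\ell_xS-S^2\ell_x$ and $r_{N(x)}S=Sr_{N(x)}+Sr_xS-S^2r_x$. *)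

(* Defs.v *)
From HB Require Import structures.
From mathcomp Require Import all_boot all_order all_algebra.

Set Implicit Arguments.
Unset Strict Implicit.
Unset Printing Implicit Defensive.

Import GRing.Theory.
Local Open Scope ring_scope.

(* Composition of endomorphisms; the library's [\o] on ['End(V)] has the same  *)
(* precedence as [+] and [-].                                                  *)
Local Notation "f ** g" := (comp_lfun f g) (at level 40, left associativity).

(* A nonassociative algebra over K is a K-vector space B with a bilinear       *)
(* product [{bilinear B -> B -> B}]; [vectType K] makes it finite-dimensional. *)

Section NonassociativeAlgebras.
Variables (K : fieldType) (B : vectType K) (m : {bilinear B -> B -> B}).
Local Notation "x · y" := (m x y) (at level 40, left associativity).

Definition pre_malcev : Prop := forall x y z t : B,
  (y · z - z · y) · (x · t)
  + ((x · y - y · x) · z - z · (x · y - y · x)) · t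
  + y · ((x · z - z · x) · t)
  - x · (y · (z · t)) + z · (x · (y · t)) = 0.

Definition nijenhuis_operator (N : 'End(B)) : Prop := forall x y : B,
  N x · N y = N (N x · y + x · N y - N (x · y)).

End NonassociativeAlgebras.

Section Bimodules.
Variables (K : fieldType) (A V : vectType K) (m : {bilinear A -> A -> A}).
Variables (l r : {linear A -> 'End(V)}).
Local Notation "x · y" := (m x y) (at level 40, left associativity).

Definition bimodule_i : Prop := forall x y z : A,
  r x ** r y ** r z - r x ** r y ** l z - r x ** l y ** r z
  + r x ** l y ** l z - r (z · (y · x)) + l y ** r (z · x)
  + l (z · y) ** r x - l (y · z) ** r x - l z ** r x ** l y
  + l z ** r x ** r y = 0.

Definition bimodule_ii : Prop := forall x y z : A,
  r x ** r y ** l z - r x ** r y ** r z - r x ** l y ** l z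
  + r x ** l y ** r z - l z ** r (y · x) + l y ** l z ** r x
  + r (z · x) ** r y - r (z · x) ** l y - r ((y · z) · x)
  + r ((z · y) · x) = 0.

Definition bimodule_iii : Prop := forall x y z : A,
  r x ** l (y · z) - r x ** l (z · y) - r x ** r (y · z)
  + r x ** r (z · y) - l y ** l z ** r x + r (y · (z · x))
  + r (y · x) ** l z - r (y · x) ** r z - l z ** r x ** r y
  + l z ** r x ** l y = 0.

Definition bimodule_iv : Prop := forall x y z : A,
  l ((x · y) · z) - l ((y · x) · z) - l (z · (x · y))
  + l (z · (y · x)) - l x ** l y ** l z + l z ** l x ** l y
  + l (y · z) ** l x - l (z · y) ** l x - l y ** l (z · x)
  + l y ** l (x · z) = 0.

Definition bimodule : Prop :=
  [/\ bimodule_i, bimodule_ii, bimodule_iii & bimodule_iv].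

Definition nijenhuis_pair (N : 'End(A)) (S : 'End(V)) : Prop :=
  [/\ nijenhuis_operator m N,
      forall x : A, l (N x) ** S
        = S ** l (N x) + S ** l x ** S - S ** S ** l x
    & forall x : A, r (N x) ** S
        = S ** r (N x) + S ** r x ** S - S ** S ** r x].

Definition semidirect (p q : A * V) : A * V :=
  (p.1 · q.1, l p.1 q.2 + r q.1 p.2).

Lemma semidirect_bilinear : bilinear_for *:%R *:%R semidirect.
Proof.
split=> [q|p] a u v; congr pair => /=.
- by rewrite linearPl.
- by rewrite !linearP !add_lfunE !scale_lfunE /= scalerDr addrACA.
- by rewrite linearPr.
- by rewrite !linearP !add_lfunE !scale_lfunE /= scalerDr addrACA.
Qed.

HB.instance Definition _ := bilinear_isBilinear.Build K (A * V)%type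
  (A * V)%type (A * V)%type *:%R *:%R semidirect semidirect_bilinear.

End Bimodules.

Section DirectSum.
Variables (K : fieldType) (A V : vectType K) (N : 'End(A)) (S : 'End(V)).

Definition dsum_fun (p : A * V) : A * V := (N p.1, S p.2).

Lemma dsum_fun_linear : linear dsum_fun.
Proof. by move=> a p q; rewrite /dsum_fun /= !linearP. Qed.

HB.instance Definition _ :=
  GRing.isLinear.Build K (A * V)%type (A * V)%type *:%R dsum_fun dsum_fun_linear.

Definition dsum : 'End((A * V)%type) := linfun dsum_fun.

Lemma dsumE (x : A) (u : V) : dsum (x, u) = (N x, S u).
Proof. by rewrite lfunE. Qed.

End DirectSum.

(* Main.v *)
Require Import Defs.
From mathcomp Require Import all_boot all_order all_algebra.
Import GRing.Theory.
Local Open Scope ring_scope.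

(** The Nijenhuis identity splits along [A * V]. Its [A]-part is that of [N]. Its [V]-part is a sum
    of terms in [v] and terms in [u]: the former are the [l]-condition at [x] applied to [v], the
    latter the [r]-condition at [y] applied to [u]. *)

Theorem proposition2p5 (K : fieldType) (charK0 : [pchar K] =i pred0)
  (A : vectType K) (m : {bilinear A -> A -> A}) (A_preMalcev : pre_malcev m)
  (V : vectType K) (l r : {linear A -> 'End(V)}) (V_bimodule : bimodule m l r)
  (N : 'End(A)) (S : 'End(V)) (NS_pair : nijenhuis_pair m l r N S) :
  nijenhuis_operator (semidirect m l r) (dsum N S).
Proof.
case: NS_pair => nijN eqL eqR [x u] [y v].
have eqLv : l (N x) (S v) = S (l (N x) v) + S (l x (S v)) - S (S (l x v)).
  by have /lfunP/(_ v) := eqL x; rewrite !lfun_simp.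
have eqRu : r (N y) (S u) = S (r (N y) u) + S (r y (S u)) - S (S (r y u)).
  by have /lfunP/(_ u) := eqR y; rewrite !lfun_simp.
rewrite !dsumE; congr pair => /=; first exact: nijN.
(* The [S (S _)] terms are gathered last on both sides; the other four differ only in order. *)
rewrite eqLv eqRu addrACA !raddfB /= !raddfD /=.
congr (_ + _).
by rewrite [RHS]addrACA [S (r y (S u)) + _]addrC.
Qed.
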